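(* Let $d\geq 0$ be an integer. Then $$\prod_{\ell>0}\ \prod_{(\lambda,\Box)\in S_{d+\ell,\ell}}\frac{1}{1-x^{a_\lambda(\Box)+1}y^{\ell_\lambda(\Box)}}=\left(\prod_{\Box''\in\mathcal{H}'(\varnothing)}\frac{1}{1-x^{a_\varnothing(\Box'')+1}y^{\ell_\varnothing(\Box'')}}\right)^{|\mathcal{P}_d|}\ \prod_{\ell>0}\ \prod_{(\lambda,\Box')\in S_{d,\ell}}\frac{1}{1-x^{a_\lambda(\Box')+1}y^{\ell_\lambda(\Box')}}.$$
   Context: A partition $\lambda=(\lambda_1\geq\lambda_2\geq\dots)$ is a finite sequence of positive integers (extended by zeros), of size $|\lambda|=\sum_i\lambda_i$. Its Young diagram is the set of boxes $(i,j)\in\mathbb{Z}_{\geq 0}^2$ with $0\leq j<\lambda_{i+1}$. Partitions are identified with their Young diagrams; $\mathcal{P}_d$ is the set of Young diagrams of size $d$, and $\varnothing$ is the empty partition. For $\Box=(i,j)\in\lambda$ the arm and leg lengths are $a_\lambda(\Box)=|\{(i,j')\in\lambda\mid j<j'\}|$ and $\ell_\lambda(\Box)=|\{(i',j)\in\lambda\mid i<i'\}|$. For $\Box=(i,j)\in\mathbb{Z}_{\ge0}^2\setminus\lambda$ they are $a_\lambda(\Box)=|\{(i,j')\notin\lambda\mid 0\le j'<j\}|$ and $\ell_\lambda(\Box)=|\{(i',j)\notin\lambda\mid 0\le i'<i\}|$. The hook length is $h_\lambda(\Box)=a_\lambda(\Box)+\ell_\lambda(\Box)+1$. Internal (resp.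 external) hooks of $\lambda$ are identified with boxes $\Box\in\lambda$ (resp. $\Box\in\mathbb{Z}_{\geq0}^2\setminus\lambda$). $\mathcal{H}'(\lambda)$ denotes the set of external hooks of $\lambda$; in particular $\mathcal{H}'(\varnothing)$ is identified with $\mathbb{Z}_{\ge0}^2$. The index $\ell$ (a hook length) is not to be confused with the leg length function $\ell_\lambda(\cdot)$. For integers $d\geq 0$ and $\ell>0$, $$S_{d,\ell}=\{(\lambda,\Box)\mid\lambda\in\mathcal{P}_d,\ \Box\in\lambda,\ h_\lambda(\Box)=\ell\},$$ which is empty if $\ell>d$. The identity holds in $\mathbb{Z}[[x,y]]$, with $x,y$ formal variables and infinite products understood as convergent products of formal power series. *)

(* Defs.v *)
From HB Require Import structures.
From mathcomp Require Import all_boot all_order all_algebra.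
From mathcomp Require Import finmap.
From mathcomp Require Import boolp classical_sets.

Set Implicit Arguments.
Unset Strict Implicit.
Unset Printing Implicit Defensive.

Import GRing.Theory.
Local Open Scope ring_scope.

(* R[[x,y]]: [coef2 f m n] is the coefficient of x^m y^n in f. *)
Record fps2 (R : Type) := Fps2 { coef2 : nat -> nat -> R }.

Lemma fps2P (R : Type) (f g : fps2 R) :
  (forall m n, coef2 f m n = coef2 g m n) -> f = g.
Proof.
case: f g => [f] [g] /= fg; congr Fps2.
by apply/funext => m; apply/funext => n.
Qed.

HB.instance Definition _ (R : Type) := gen_eqMixin (fps2 R).
HB.instance Definition _ (R : Type) := gen_choiceMixin (fps2 R).

Section Ring.
Variable R : comNzRingType.
Implicit Types f g h : fps2 R.

Definition fps2_zero : fps2 R := Fps2 (fun _ _ => 0).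
Definition fps2_opp f : fps2 R := Fps2 (fun m n => - coef2 f m n).
Definition fps2_add f g : fps2 R :=
  Fps2 (fun m n => coef2 f m n + coef2 g m n).
Definition fps2_one : fps2 R := Fps2 (fun m n => ((m == 0) && (n == 0))%:R).
Definition fps2_mul f g : fps2 R :=
  Fps2 (fun m n => \sum_(i < m.+1) \sum_(j < n.+1)
          coef2 f i j * coef2 g (m - i) (n - j)).

Fact fps2_addA : associative fps2_add.
Proof. by move=> f g h; apply: fps2P => m n /=; rewrite addrA. Qed.
Fact fps2_addC : commutative fps2_add.
Proof. by move=> f g; apply: fps2P => m n /=; rewrite addrC. Qed.
Fact fps2_add0 : left_id fps2_zero fps2_add.
Proof. by move=> f; apply: fps2P => m n /=; rewrite add0r. Qed.
Fact fps2_addN : left_inverse fps2_zero fps2_opp fps2_add.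
Proof. by move=> f; apply: fps2P => m n /=; rewrite addNr. Qed.

HB.instance Definition _ := GRing.isZmodule.Build (fps2 R)
  fps2_addA fps2_addC fps2_add0 fps2_addN.

(* The ring axioms are transferred from {poly {poly R}} by truncation. *)
Let agree (N : nat) (p : {poly {poly R}}) f :=
  forall m n, (m < N)%N -> (n < N)%N -> p`_m`_n = coef2 f m n.

Let trunc (N : nat) f : {poly {poly R}} :=
  \poly_(i < N) \poly_(j < N) coef2 f i j.

Let agree_trunc N f : agree N (trunc N f) f.
Proof. by move=> m n mN nN; rewrite coef_poly mN coef_poly nN. Qed.

Let agree_mul N p q f g :
  agree N p f -> agree N q g -> agree N (p * q) (fps2_mul f g).
Proof.
move=> pf qg m n mN nN /=; rewrite coefM coef_sum; apply: eq_bigr => i _.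
rewrite coefM; apply: eq_bigr => j _; rewrite pf ?qg //.
- exact: leq_ltn_trans (leq_subr _ _) mN.
- exact: leq_ltn_trans (leq_subr _ _) nN.
- by apply: leq_ltn_trans mN; rewrite -ltnS.
- by apply: leq_ltn_trans nN; rewrite -ltnS.
Qed.

Let agree_one N : agree N 1 fps2_one.
Proof.
by move=> m n _ _; rewrite coef1; case: m => [|m] /=; rewrite ?coef1 ?coef0.
Qed.

Let agree_add N p q f g :
  agree N p f -> agree N q g -> agree N (p + q) (fps2_add f g).
Proof. by move=> pf qg m n mN nN; rewrite !coefD /= pf ?qg. Qed.

Let agree_eq f g :
  (forall N, exists2 p, agree N p f & agree N p g) -> f = g.
Proof.
move=> H; apply: fps2P => m n; have [p pf pg] := H (m + n).+1.
by rewrite -pf ?pg // ltnS ?leq_addr ?leq_addl.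
Qed.

Fact fps2_mulA : associative fps2_mul.
Proof.
move=> f g h; apply: agree_eq => N.
exists (trunc N f * (trunc N g * trunc N h)); last rewrite mulrA.
- by do !apply: agree_mul; apply: agree_trunc.
- by do !apply: agree_mul; apply: agree_trunc.
Qed.
Fact fps2_mulC : commutative fps2_mul.
Proof.
move=> f g; apply: agree_eq => N.
exists (trunc N f * trunc N g); last rewrite mulrC.
- by apply: agree_mul; apply: agree_trunc.
- by apply: agree_mul; apply: agree_trunc.
Qed.
Fact fps2_mul1 : left_id fps2_one fps2_mul.
Proof.
move=> f; apply: agree_eq => N; exists (1 * trunc N f); last rewrite mul1r.
- by apply: agree_mul; [apply: agree_one | apply: agree_trunc].
- exact: agree_trunc.
Qed.
Fact fps2_mulD : left_distributive fps2_mul fps2_add.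
Proof.
move=> f g h; apply: agree_eq => N.
exists ((trunc N f + trunc N g) * trunc N h); last rewrite mulrDl.
- by apply: agree_mul; [apply: agree_add|]; apply: agree_trunc.
- by apply: agree_add; apply: agree_mul; apply: agree_trunc.
Qed.
Fact fps2_one_neq0 : fps2_one != fps2_zero.
Proof.
apply/eqP => /(congr1 (fun f => coef2 f 0 0)) /= /eqP.
by rewrite oner_eq0.
Qed.

HB.instance Definition _ := GRing.Zmodule_isComNzRing.Build (fps2 R)
  fps2_mulA fps2_mulC fps2_mul1 fps2_mulD fps2_one_neq0.

(* The library's convention: f^-1 is the inverse of f if f is invertible, and
   f itself otherwise. *)
Definition fps2_unit : {pred fps2 R} := fun f => `[< exists g, g * f = 1 >].
Definition fps2_inv f : fps2 R := xget f [set g | g * f = 1].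

Fact fps2_mulVr : {in fps2_unit, left_inverse 1 fps2_inv *%R}.
Proof.
move=> f /asboolP [g gf]; rewrite /fps2_inv.
by case: xgetP => [_ -> //|/(_ g)].
Qed.
Fact fps2_unitP f g : g * f = 1 -> fps2_unit f.
Proof. by move=> gf; apply/asboolP; exists g. Qed.
Fact fps2_inv_out : {in [predC fps2_unit], fps2_inv =1 id}.
Proof.
move=> f /asboolP nf; rewrite /fps2_inv.
by case: xgetP => // g _ gf; case: nf; exists g.
Qed.

HB.instance Definition _ := GRing.ComNzRing_hasMulInverse.Build (fps2 R)
  fps2_mulVr fps2_unitP fps2_inv_out.

Definition fps2_X : fps2 R := Fps2 (fun m n => ((m == 1) && (n == 0))%:R).
Definition fps2_Y : fps2 R := Fps2 (fun m n => ((m == 0) && (n == 1))%:R).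

Lemma coef2M f g m n : coef2 (f * g) m n =
  \sum_(i < m.+1) \sum_(j < n.+1) coef2 f i j * coef2 g (m - i) (n - j).
Proof. by []. Qed.

Lemma coef2D f g m n : coef2 (f + g) m n = coef2 f m n + coef2 g m n.
Proof. by []. Qed.

Lemma coef2B f g m n : coef2 (f - g) m n = coef2 f m n - coef2 g m n.
Proof. by []. Qed.

Lemma coef2X_small f k m n :
  coef2 f 0 0 = 0 -> (m + n < k)%N -> coef2 (f ^+ k) m n = 0.
Proof.
move=> f0; elim: k m n => // k IHk m n mnk; rewrite exprS coef2M.
apply: big1 => i _; apply: big1 => j _.
have im : (i <= m)%N by rewrite -ltnS.
have jn : (j <= n)%N by rewrite -ltnS.
have [ij0|ij_gt0] := posnP (i + j)%N.
  move/eqP: ij0; rewrite addn_eq0 => /andP[/eqP -> /eqP ->].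
  by rewrite f0 mul0r.
have mnE : (m - i + (n - j) + (i + j) = m + n)%N by rewrite addnACA !subnK.
rewrite IHk ?mulr0 //; apply: leq_trans (_ : m + n <= k)%N; last exact: mnk.
by rewrite -mnE -addn1 leq_add2l.
Qed.

Lemma fps2_unit_1B f : coef2 f 0 0 = 0 -> 1 - f \is a GRing.unit.
Proof.
move=> f0.
pose S N : fps2 R := \sum_(k < N) f ^+ k.
have S_stable m n N : (m + n < N)%N ->
    coef2 (S N) m n = coef2 (S (m + n).+1) m n.
  elim: N => // N IHN; rewrite ltnS leq_eqVlt => /orP[/eqP <- //|mnN].
  rewrite {1}/S big_ord_recr coef2D -/(S N) IHN //=.
  by rewrite coef2X_small ?addr0.
pose g : fps2 R := Fps2 (fun m n => coef2 (S (m + n).+1) m n).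
suff g1 : g * (1 - f) = 1 by apply/unitrPr; exists g; rewrite mulrC.
apply: fps2P => m n; pose N := (m + n).+1.
have -> : coef2 (g * (1 - f)) m n = coef2 (S N * (1 - f)) m n.
  rewrite !coef2M; apply: eq_bigr => i _; apply: eq_bigr => j _.
  by rewrite (S_stable i j N) // ltnS leq_add // -ltnS.
have -> : S N * (1 - f) = 1 - f ^+ N.
  by rewrite -[in RHS](expr1n _ N) subrXX mulrC; congr (_ * _);
     apply: eq_bigr => k _; rewrite expr1n mul1r.
by rewrite coef2B coef2X_small ?subr0.
Qed.

End Ring.

Arguments fps2_X {R}.
Arguments fps2_Y {R}.

(* The product of the F i over the indices i satisfying D converges to f: every
   coefficient of the finite partial products is eventually, along the finite
   sets of indices directed by inclusion, that of f. *)
Definition has_prod (R : comNzRingType) (I : choiceType) (D : pred I)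
    (F : I -> fps2 R) (f : fps2 R) : Prop :=
  forall m n : nat, exists A0 : {fset I}, forall A : {fset I},
    (A0 `<=` A)%fset -> coef2 (\prod_(i <- A | D i) F i) m n = coef2 f m n.

Definition multipliable (R : comNzRingType) (I : choiceType) (D : pred I)
    (F : I -> fps2 R) : Prop :=
  exists f, has_prod D F f.

(* 1 if the product does not converge *)
Definition infprod (R : comNzRingType) (I : choiceType) (D : pred I)
    (F : I -> fps2 R) : fps2 R :=
  xget 1 [set f | has_prod D F f].

Lemma has_prod_unique (R : comNzRingType) (I : choiceType) (D : pred I)
    (F : I -> fps2 R) (f g : fps2 R) :
  has_prod D F f -> has_prod D F g -> f = g.
Proof.
move=> Ff Fg; apply: fps2P => m n.
have [A HA] := Ff m n; have [B HB] := Fg m n.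
by rewrite -(HA (A `|` B)%fset) ?fsubsetUl // HB ?fsubsetUr.
Qed.

Definition is_part (s : seq nat) : bool := sorted geq s && (0 \notin s).

Record intpart := Intpart { parts :> seq nat; _ : is_part parts }.

HB.instance Definition _ := [isSub for parts].
HB.instance Definition _ := [Countable of intpart by <:].

Definition empty_part : intpart := @Intpart [::] isT.

Definition part_size (p : intpart) : nat := sumn p.

Record intpart_of (d : nat) := IntpartOf {
  intpart_of_val :> intpart;
  _ : part_size intpart_of_val == d }.

HB.instance Definition _ d := [isSub for @intpart_of_val d].
HB.instance Definition _ d := [Countable of intpart_of d by <:].

Section IntpartFinite.
Variable d : nat.

Let code (p : intpart_of d) : d.-bseq 'I_d.+1 :=
  insub_bseq d [seq inord i | i <- parts p].
Let decode (s : d.-bseq 'I_d.+1) : option (intpart_of d) :=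
  obind (fun p : intpart => insub p) (insub [seq val i | i <- s]).

Let leq_sumn s i : i \in s -> (i <= sumn s)%N.
Proof.
elim: s => // x s IHs; rewrite inE => /predU1P[->|/IHs H] /=.
  exact: leq_addr.
exact: leq_trans H (leq_addl _ _).
Qed.

Let size_sumn s : 0 \notin s -> (size s <= sumn s)%N.
Proof.
elim: s => // x s IHs; rewrite inE negb_or eq_sym -lt0n => /andP[x0 /IHs H] /=.
by rewrite -add1n leq_add.
Qed.

Let codeK : pcancel code decode.
Proof.
move=> p; have /andP[_ p0] : is_part p by exact: (valP (intpart_of_val p)).
have /eqP pd : sumn p == d by exact: (valP p).
have ps : (size p <= d)%N by rewrite -[leqRHS]pd size_sumn.
rewrite /decode /code val_insubd size_map ps -map_comp.
rewrite (_ : [seq _ | _ <- _] = parts p); first by rewrite valK /= valK.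
rewrite -[RHS]map_id; apply/eq_in_map => i ip /=.
by rewrite inordK // ltnS -[leqRHS]pd leq_sumn.
Qed.

HB.instance Definition _ : isFinite (intpart_of d) := PCanIsFinite codeK.
End IntpartFinite.

(* The Young diagram; [nth 0 p i] is the (i+1)-st part of p, or 0. *)
Definition diagram (p : intpart) : {fset nat * nat} :=
  [fset ((i, j) : nat * nat) | i in iota 0 (size p),
     j in iota 0 (nth 0 p i)]%fset.

Lemma in_diagram (p : intpart) (b : nat * nat) :
  (b \in diagram p) = (b.2 < nth 0 p b.1)%N.
Proof.
apply/imfset2P/idP => /= [[i ip [j jp ->]]|].
  by move: jp; rewrite mem_iota.
case: b => i j /= jp; exists i; last by exists j; rewrite ?mem_iota.
rewrite mem_iota /= add0n ltnNge; apply/negP => ip.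
by rewrite nth_default in jp.
Qed.

Definition arm (p : intpart) (b : nat * nat) : nat :=
  if b \in diagram p
  then #|` [fset c in diagram p | (c.1 == b.1) && (b.2 < c.2)%N]%fset |
  else #|[set j : 'I_b.2 | (b.1, val j) \notin diagram p]|.

Definition leg (p : intpart) (b : nat * nat) : nat :=
  if b \in diagram p
  then #|` [fset c in diagram p | (c.2 == b.2) && (b.1 < c.1)%N]%fset |
  else #|[set i : 'I_b.1 | (val i, b.2) \notin diagram p]|.

Definition hook (p : intpart) (b : nat * nat) : nat :=
  (arm p b + leg p b).+1.

Definition external_hooks (p : intpart) : pred (nat * nat) :=
  [pred b | b \notin diagram p].

Definition hooks_of_length (d l : nat) : {fset intpart_of d * (nat * nat)} :=
  [fset ((p, b) : intpart_of d * (nat * nat)) | p in {: intpart_of d},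
     b in diagram (intpart_of_val p) & hook p b == l]%fset.

Lemma in_hooks_of_length (d l : nat) (x : intpart_of d * (nat * nat)) :
  (x \in hooks_of_length d l) = (x.2 \in diagram x.1) && (hook x.1 x.2 == l).
Proof.
apply/imfset2P/idP => /= [[p _ [b + ->]]|]; first by rewrite inE.
by case: x => p b /= pb; exists p => //; exists b; rewrite ?inE.
Qed.

Definition hook_factor (p : intpart) (b : nat * nat) : fps2 int :=
  (1 - fps2_X ^+ (arm p b).+1 * fps2_Y ^+ leg p b)^-1.

Lemma hook_factor_unit (p : intpart) (b : nat * nat) :
  1 - fps2_X ^+ (arm p b).+1 * fps2_Y ^+ leg p b \is a @GRing.unit (fps2 int).
Proof.
apply: fps2_unit_1B.
by rewrite exprS -mulrA coef2M !big_ord1 mul0r.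
Qed.

(* Main.v *)
Require Import Defs.
From mathcomp Require Import all_boot all_order all_algebra.
From mathcomp Require Import finmap.
From mathcomp Require Import boolp classical_sets.
From mathcomp Require Import zify.

(** Every factor depends only on the arm a and the leg b of its hook, and every
    pair (a, b) is the arm and leg of exactly one external hook of the empty
    partition, namely of the box (b, a).  So the identity says, for all a and b
    and with l = a + b + 1, that the number of hooks with arm a and leg b in the
    partitions of d + l exceeds by #|P_d| the number of such hooks in the
    partitions of d.

    A hook of arm a and leg b with hand in row i of a partition g of d + l is
    the same as a row i with g_(i+b+1) < g_i - a <= g_(i+b) ([removable_row]):
    the box is then in column g_i - a - 1.  Removing the corresponding rim hook
    yields a partition f of d together with a row i at which a rim hook of that
    shape can be added ([addable_row]), and this is a bijection
    ([sum_removable_addable]).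

    It remains to see that every fixed partition f of d has exactly one more
    addable row than removable rows ([sum_addable_row]).  Write C_i for
    f_(i+b+1) + a < f_i and A_i for f_i <= f_(i+b) + a.  Row i is addable when
    C_(i-1) and A_i hold, with C_(-1) true by convention, and removable when A_i
    and C_i hold.  As f is nonincreasing, the failure of A_i implies both
    C_(i-1) and C_i, so the two indicators differ by [C_(i-1)] - [C_i]; the
    difference telescopes to [C_(-1)] = 1, because C_i fails for large i.

    This gives an identity of finite products for every l ([prod_hooks_shift]),
    in which the external hooks of the empty partition are grouped by hook
    length.  It passes to the infinite products because a hook of length l
    contributes a factor that is 1 up to terms of total degree at least l, and
    because convergent products may be multiplied ([has_prodM]) and grouped into
    finite blocks ([has_prod_blocks]). *)

Set Implicit Arguments.
Unset Strict Implicit.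
Unset Printing Implicit Defensive.

(** * Partitions as nonincreasing sequences *)

Definition part (p : intpart) (k : nat) : nat := nth 0 p k.

Lemma part_anti (p : intpart) i j : i <= j -> part p j <= part p i.
Proof.
move=> ij; have /andP[ps _] : is_part p := valP p.
have [jp|pj] := ltnP j (size p); last by rewrite /part nth_default.
have geq_trans : transitive geq by move=> x y z yx zy; apply: leq_trans zy yx.
apply: (sorted_leq_nth geq_trans leqnn 0 ps) => //.
exact: leq_ltn_trans jp.
Qed.

(** No part is 0, so the number of parts is the number of rows k with
    [part p k] > 0 and the list of parts is determined by [part p]. *)
Lemma part_inj (p q : intpart) : part p =1 part q -> p = q.
Proof.
have pos (r : intpart) k : (k < size r) = (0 < part r k).
  have [kr|rk] := ltnP k (size r); last by rewrite /part nth_default.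
  have /andP[_ r0] : is_part r := valP r.
  apply/esym; rewrite lt0n; apply: contra r0 => /eqP rk0.
  by have := mem_nth 0 kr; rewrite -/(part r k) rk0.
move=> pq; apply/val_inj/(@eq_from_nth _ 0) => [/=|i _]; last exact: pq.
have := pos p (size q); have := pos q (size p); have := pos p (size p).
have := pos q (size q); rewrite -!pq !ltnn.
by case: (ltngtP (size p) (size q)) => // _; lia.
Qed.

Lemma sum_nth (s : seq nat) N : size s <= N -> \sum_(k < N) nth 0 s k = sumn s.
Proof.
elim: s N => [|x s IHs] [|N] //= sN; first by rewrite big_ord0.
  by apply: big1 => k _; rewrite nth_nil.
by rewrite big_ord_recl /= IHs.
Qed.

Lemma size_part (p : intpart) : size p <= part_size p.
Proof.
have /andP[_] : is_part p := valP p.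
rewrite /part_size; elim: (parts p) => //= x s IHs.
by rewrite inE negb_or => /andP[x0 /IHs]; lia.
Qed.

Lemma part_sizeE n (p : intpart_of n) : part_size p = n.
Proof. exact/eqP/(valP p). Qed.

Lemma sum_part n (p : intpart_of n) N : n <= N -> \sum_(k < N) part p k = n.
Proof.
move=> nN; rewrite -[RHS](part_sizeE p) /part_size -(@sum_nth _ N) //.
by apply: leq_trans (size_part p) _; rewrite part_sizeE.
Qed.

Lemma part_large n (p : intpart_of n) k : n <= k -> part p k = 0.
Proof.
move=> nk; rewrite /part nth_default //.
by apply: leq_trans (size_part p) _; rewrite part_sizeE.
Qed.

(** N need not be the number of parts: zeros of f before N are cut off. *)
Lemma ex_intpart_of n (f : nat -> nat) N :
  (forall k, f k.+1 <= f k) -> (forall k, N <= k -> f k = 0) ->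
  \sum_(k < N) f k = n -> exists p : intpart_of n, part p = f.
Proof.
move=> f_anti f0 fn.
have ex0 : exists k, f k == 0 by exists N; rewrite f0.
case: (ex_minnP ex0) => M /eqP fM Mmin.
have fpos k : k < M -> 0 < f k.
  by move=> kM; rewrite lt0n; apply: contraL kM => /Mmin; rewrite -leqNgt.
have fMk k : M <= k -> f k = 0.
  move=> /subnK <-; elim: (k - M) => [//|m IHm]; rewrite addSn.
  by have := f_anti (m + M); lia.
have sE k : nth 0 (mkseq f M) k = f k.
  have [kM|Mk] := ltnP k M; first by rewrite nth_mkseq.
  by rewrite nth_default ?size_mkseq // fMk.
have sP : is_part (mkseq f M).
  apply/andP; split.
    by apply/(sortedP 0) => i _; rewrite !sE; apply: f_anti.
  by apply/mapP => -[k]; rewrite mem_iota /= add0n => /fpos; lia.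
have MN : M <= N by apply: Mmin; rewrite f0.
have sn : part_size (Intpart sP) == n.
  rewrite /part_size /= -(@sum_nth _ N) ?size_mkseq // -fn.
  by apply/eqP/eq_bigr => k _; rewrite sE.
by exists (IntpartOf sn); apply/funext => k; rewrite /part /= sE.
Qed.

(** * Arms and legs in terms of parts *)

Lemma mem_diagram (p : intpart) b : (b \in diagram p) = (b.2 < part p b.1).
Proof. exact: in_diagram. Qed.

(** The column heights stand for the parts of the conjugate partition. *)
Lemma ex_column_height (p : intpart) j :
  exists c, forall k, (j < part p k) = (k < c).
Proof.
have ex0 : exists k, part p k <= j.
  by exists (size p); rewrite /part nth_default.
case: (ex_minnP ex0) => c pc cmin; exists c => k.
have [kc|ck] := ltnP k c; last first.
  by apply/negbTE; rewrite -leqNgt; apply: leq_trans pc; apply: part_anti.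
by rewrite ltnNge; apply: contraL kc => /cmin; rewrite -leqNgt.
Qed.

Lemma card_fset_seq (K : choiceType) (A : {fset K}) (s : seq K) :
  uniq s -> s =i A -> #|` A| = size s.
Proof.
by move=> sU sA; apply/esym/perm_size/uniq_perm => //; apply: fset_uniq.
Qed.

Lemma arm_diagram (p : intpart) i j :
  (i, j) \in diagram p -> arm p (i, j) = part p i - j.+1.
Proof.
move=> ij; rewrite /arm ij.
rewrite (@card_fset_seq _ _ [seq (i, k) | k <- iota j.+1 (part p i - j.+1)]).
- by rewrite size_map size_iota.
- by rewrite map_inj_uniq ?iota_uniq // => k k' [].
case=> i' k; rewrite !inE mem_diagram /=.
apply/mapP/and3P => [[k' + [-> ->]]|[kp /eqP iE jk]].
  by rewrite mem_iota eqxx; split=> //; lia.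
by move: kp; rewrite iE => kp; exists k => //; rewrite mem_iota; lia.
Qed.

(** The leg is b when the column of the box ends in row i + b; this compares
    parts with j and avoids the conjugate partition. *)
Lemma leg_diagram (p : intpart) i j b :
  (i, j) \in diagram p ->
  (leg p (i, j) == b) = (j < part p (i + b)) && (part p (i + b).+1 <= j).
Proof.
move=> ij; have [c cP] := ex_column_height p j.
have ic : i < c by rewrite -cP; move: ij; rewrite mem_diagram.
have -> : leg p (i, j) = c - i.+1.
  rewrite /leg ij (@card_fset_seq _ _ [seq (k, j) | k <- iota i.+1 (c - i.+1)]).
  - by rewrite size_map size_iota.
  - by rewrite map_inj_uniq ?iota_uniq // => k k' [].
  case=> k j'; rewrite !inE mem_diagram /=.
  apply/mapP/and3P => [[k' + [-> ->]]|[kp /eqP jE ik]].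
    by rewrite mem_iota eqxx cP; split=> //; lia.
  by move: kp; rewrite jE cP => kc; exists k => //; rewrite mem_iota; lia.
by rewrite cP (leqNgt (part _ _)) cP; lia.
Qed.

Lemma arm_empty b : arm empty_part b = b.2.
Proof.
rewrite /arm mem_diagram /part nth_nil /= -[RHS]card_ord -cardsT.
by apply: eq_card => k; rewrite !inE mem_diagram /part nth_nil.
Qed.

Lemma leg_empty b : leg empty_part b = b.1.
Proof.
rewrite /leg mem_diagram /part nth_nil /= -[RHS]card_ord -cardsT.
by apply: eq_card => k; rewrite !inE mem_diagram /part nth_nil.
Qed.

(** * Adding and removing rim hooks *)

(** f has a box with arm a and leg b in row i: its column can only be
    f i - a - 1, and the column must end in row i + b.  The subtraction is moved
    to the other side, so that no truncation occurs. *)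
Definition removable_row (a b : nat) (f : nat -> nat) (i : nat) : bool :=
  (f i <= f (i + b) + a) && (f (i + b).+1 + a < f i).

(** A rim hook of arm a and leg b can be added in rows i, ..., i + b.  Row i
    then gets length f (i + b) + a + 1, which must be at most the length of row
    i - 1 and larger than the old row i. *)
Definition addable_row (a b : nat) (f : nat -> nat) (i : nat) : bool :=
  ((i == 0) || (f (i + b) + a < f i.-1)) && (f i <= f (i + b) + a).

(** The arm of a box and its row determine its column, so that rows can be
    counted in place of boxes. *)
Lemma count_hooks n N a b : n <= N ->
  count (fun x : intpart_of n * (nat * nat) => arm x.1 x.2 == a)
    (hooks_of_length n (a + b).+1) =
  \sum_(p : intpart_of n) \sum_(i < N) removable_row a b (part p) i.
Proof.
move=> nN; rewrite pair_big /= -big_mkcond /= sum1_card -size_filter.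
pose row_box (x : intpart_of n * 'I_N) : intpart_of n * (nat * nat) :=
  (x.1, (nat_of_ord x.2, part x.1 x.2 - a.+1)).
rewrite cardE -(size_map row_box); apply/perm_size/uniq_perm.
- by rewrite filter_uniq ?fset_uniq.
- rewrite map_inj_uniq ?enum_uniq // => -[p i] [q j] [-> /val_inj -> _] //.
case=> p [i j]; rewrite mem_filter in_hooks_of_length /=.
apply/and3P/mapP => /= [[/eqP aE ij hE]|[[q k]]]; last first.
  rewrite mem_enum unfold_in /= => /andP[q1 q2] [-> -> ->].
  have qk : (nat_of_ord k, part q k - a.+1) \in diagram q.
    by rewrite mem_diagram /=; lia.
  have aE : arm q (nat_of_ord k, part q k - a.+1) = a.
    by rewrite arm_diagram //; lia.
  split=> //; first exact/eqP.
  by rewrite /hook aE eqSS eqn_add2l leg_diagram //; lia.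
have := ij; rewrite mem_diagram /= => jp.
have iN : i < N.
  apply: contraLR jp; rewrite -!leqNgt => Ni.
  by rewrite (part_large p) ?(leq_trans nN).
have := arm_diagram ij; rewrite aE => aE'.
exists (p, Ordinal iN); last by rewrite /row_box /=; congr (_, (_, _)); lia.
move: hE; rewrite /hook aE eqSS eqn_add2l leg_diagram // => /andP[h1 h2].
by rewrite mem_enum unfold_in /=; apply/andP; split; lia.
Qed.

(** The two indicators differ by a telescoping term: [above i] says that row
    i - 1, if there is one, is long enough for a rim hook ending in row i + b;
    this is C_(i-1) of the introduction. *)
Lemma sum_addable_row a b (f : nat -> nat) N :
  (forall k, f k.+1 <= f k) -> f N = 0 ->
  \sum_(i < N.+1) addable_row a b f i =
  (\sum_(i < N.+1) removable_row a b f i).+1.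
Proof.
move=> f_anti fN.
pose above i := (i == 0) || (f (i + b) + a < f i.-1).
suff E M : \sum_(i < M) addable_row a b f i + above M =
           (\sum_(i < M) removable_row a b f i).+1.
  by rewrite -(E N.+1) /above /= fN addn0.
elim: M => [|M IHM]; first by rewrite !big_ord0.
have step : addable_row a b f M + above M.+1 = removable_row a b f M + above M.
  rewrite /addable_row /removable_row /above addSn /=.
  have := f_anti (M + b); have := f_anti M.-1.
  case: M {IHM} => [|M] /= f1 f2; first lia.
  case: (leqP (f M.+1) (f (M.+1 + b) + a)) => h /=; last lia.
  by rewrite andbT addnC.
rewrite !big_ord_recr /= -addnA step (addnC (removable_row _ _ _ _)).
by rewrite addnA IHM addSn.
Qed.

(** Adding a rim hook to f in rows i, ..., i + b shifts the rows i, ...,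
    i + b - 1 down by one and right by one, and puts the old row i + b, extended
    by a + 1 boxes, on top of them. *)
Definition rim_hook_added (a b i : nat) (f g : nat -> nat) : Prop :=
  [/\ forall k, k < i -> g k = f k,
      g i = f (i + b) + a.+1,
      forall k, i <= k < i + b -> g k.+1 = (f k).+1
    & forall k, i + b < k -> g k = f k].

Lemma rim_hook_added_sum a b i f g N : i + b < N -> rim_hook_added a b i f g ->
  \sum_(k < N) g k = \sum_(k < N) f k + (a + b).+1.
Proof.
move=> ibN [glo gi gmid ghi].
rewrite -!(big_mkord xpredT) !(@big_cat_nat _ _ _ i 0 N) //=; try lia.
rewrite !(@big_cat_nat _ _ _ (i + b).+1 i N) //=; try lia.
have -> : \sum_(0 <= k < i) g k = \sum_(0 <= k < i) f k.
  by apply: eq_big_nat => k ki; apply: glo.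
have -> : \sum_((i + b).+1 <= k < N) g k = \sum_((i + b).+1 <= k < N) f k.
  by apply: eq_big_nat => k ki; apply: ghi; lia.
have -> : \sum_(i <= k < (i + b).+1) g k = g i + \sum_(i <= k < i + b) g k.+1.
  by rewrite big_ltn ?ltnS ?leq_addr // big_add1.
rewrite gi (@big_nat_recr _ _ _ (i + b) i) ?leq_addr //=.
have -> : \sum_(i <= k < i + b) g k.+1 = \sum_(i <= k < i + b) f k + b.
  rewrite (eq_big_nat _ _ gmid).
  rewrite (eq_bigr (fun k => f k + 1)) => [|k _]; last by rewrite addn1.
  by rewrite big_split /= sum_nat_const_nat muln1 addKn.
lia.
Qed.

Lemma rim_hook_added_fun a b i f f' g g' :
  rim_hook_added a b i f g -> rim_hook_added a b i f' g' ->
  f =1 f' -> g =1 g'.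
Proof.
move=> [glo gi gmid ghi] [glo' gi' gmid' ghi'] ff k.
have [ki|ik|->] := ltngtP k i; last by rewrite gi gi' ff.
  by rewrite glo // glo'.
have [kib|ibk] := leqP k (i + b); last by rewrite ghi // ghi'.
by case: k ik kib => // k ik kib; rewrite gmid ?gmid' ?ff; lia.
Qed.

Lemma rim_hook_added_inj a b i f f' g g' :
  rim_hook_added a b i f g -> rim_hook_added a b i f' g' ->
  g =1 g' -> f =1 f'.
Proof.
move=> [glo gi gmid ghi] [glo' gi' gmid' ghi'] gg k.
have [ki|ik] := ltnP k i; first by rewrite -glo // -glo'.
have [kib|ibk|->] := ltngtP k (i + b).
- by apply: succn_inj; rewrite -gmid ?ik // -gmid' ?ik // gg.
- by rewrite -ghi // -ghi'.
- by apply: (@addIn a.+1); rewrite -gi -gi' gg.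
Qed.

(** When b = 0 there are no shifted rows, and the last row of the rim hook is
    also the first one; this is why b is split into cases at the bottom row. *)
Lemma addable_rowP a b i f :
  (forall m n, m <= n -> f n <= f m) -> addable_row a b f i ->
  exists g, [/\ rim_hook_added a b i f g, forall k, g k.+1 <= g k
               & removable_row a b g i].
Proof.
move=> f_anti /andP[f_above f_i].
pose g k := if k < i then f k else if k == i then f (i + b) + a.+1
            else if k <= i + b then (f k.-1).+1 else f k.
have gP : rim_hook_added a b i f g.
  split=> [k ki|||k ik]; rewrite /g.
  - by rewrite ki.
  - by rewrite ltnn eqxx.
  - by move=> k ik; do ![case: ifP => ?] => //; lia.
  - by do ![case: ifP => ?] => //; lia.
exists g; clearbody g; have [glo gi gmid ghi] := gP; split=> // [k|].
- have [ki|ik] := ltnP k i.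
    have := f_anti k k.+1 (leqnSn k); rewrite (glo k) //.
    move: ki; rewrite leq_eqVlt => /predU1P[ki|ki]; last by rewrite glo.
    by move: f_above; rewrite ki gi -ki /=; lia.
  have [kib|ibk] := ltnP k (i + b).
    rewrite gmid ?ik //; move: ik; rewrite leq_eqVlt => /predU1P[ik|].
      by rewrite -ik gi; lia.
    case: k kib => // k kib ik; rewrite gmid; last lia.
    by have := f_anti k k.+1 (leqnSn k); lia.
  rewrite ghi //; have := f_anti k k.+1 (leqnSn k).
  move: ibk; rewrite leq_eqVlt => /predU1P[ibk|/ghi -> //].
  rewrite -ibk; case: (b) gmid gi => [|b'] gmid gi.
    by rewrite addn0 gi addn0; lia.
  rewrite (addnS i) gmid; last lia.
  by have := f_anti (i + b') (i + b').+1 (leqnSn _); lia.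
rewrite /removable_row gi (ghi (i + b).+1) //; apply/andP; split; last first.
  by have := f_anti (i + b) (i + b).+1 (leqnSn _); lia.
case: (b) gmid gi => [|b'] gmid gi; first by rewrite addn0 gi addn0; lia.
rewrite (addnS i) gmid; last lia.
by have := f_anti (i + b') (i + b').+1 (leqnSn _); lia.
Qed.

Lemma removable_rowP a b i g :
  (forall m n, m <= n -> g n <= g m) -> removable_row a b g i ->
  exists f, [/\ rim_hook_added a b i f g, forall k, f k.+1 <= f k
               & addable_row a b f i].
Proof.
move=> g_anti /andP[g_i g_below].
pose f k := if k < i then g k else if k < i + b then (g k.+1).-1
            else if k == i + b then g i - a.+1 else g k.
have flo k : k < i -> f k = g k by rewrite /f => ->.
have fmid k : i <= k < i + b -> (f k).+1 = g k.+1.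
  move=> ik; have := g_anti k.+1 (i + b); rewrite /f.
  by do ![case: ifP => ?]; lia.
have fib : f (i + b) = g i - a.+1.
  by rewrite /f; do ![case: ifP => ?] => //; lia.
have fhi k : i + b < k -> f k = g k.
  by rewrite /f => ?; do ![case: ifP => ?] => //; lia.
exists f; clearbody f.
have f_i : f i < g i.
  case: (b) fmid fib => [|b'] fmid fib; first by rewrite addn0 in fib; lia.
  by rewrite fmid ?g_anti //; lia.
split.
- split=> [k /flo -> //||k /fmid -> //|k /fhi -> //].
  by rewrite fib; lia.
- move=> k; have gk := g_anti k k.+1 (leqnSn k).
  have [ki|ik] := ltnP k i.
    rewrite (flo k) //; move: ki; rewrite leq_eqVlt => /predU1P[ki|ki].
      by rewrite ki; move: gk f_i; rewrite ki; lia.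
    by rewrite flo.
  have [kib|ibk] := ltnP k (i + b).
    have := fmid k; rewrite ik kib => /(_ isT) => fk.
    move: kib; rewrite leq_eqVlt => /predU1P[kib|kib].
      by rewrite kib fib; move: fk; rewrite kib; lia.
    have := fmid k.+1; have := g_anti k.+1 k.+2 (leqnSn _); lia.
  rewrite fhi //; move: ibk; rewrite leq_eqVlt => /predU1P[<-|/fhi -> //].
  by rewrite fib; lia.
- apply/andP; split; last by rewrite fib; lia.
  case: i {fmid fhi f_i} flo fib g_i g_below => //= i flo fib g_i g_below.
  by rewrite (flo i) // fib; have := g_anti i i.+1 (leqnSn i); lia.
Qed.

(** Both cardinals count the pairs of A x B that are related by S. *)
Lemma eq_card_rel (T U : finType) (A : {pred T}) (B : {pred U})
    (S : T -> U -> Prop) :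
  (forall x, x \in A -> exists2 y, y \in B & S x y) ->
  (forall y, y \in B -> exists2 x, x \in A & S x y) ->
  (forall x y y', S x y -> S x y' -> y = y') ->
  (forall x x' y, S x y -> S x' y -> x = x') ->
  #|A| = #|B|.
Proof.
move=> AB BA Sfun Sinj.
have cardA x : x \in A -> \sum_(y in B) `[< S x y >] = 1.
  move=> /AB[y yB Sxy]; rewrite (bigD1 y) //= asboolT // big1 // => z /andP[_].
  by case: asboolP => // Sxz; rewrite (Sfun _ _ _ Sxz Sxy) eqxx.
have cardB y : y \in B -> \sum_(x in A) `[< S x y >] = 1.
  move=> /BA[x xA Sxy]; rewrite (bigD1 x) //= asboolT // big1 // => z /andP[_].
  by case: asboolP => // Szy; rewrite (Sinj _ _ _ Szy Sxy) eqxx.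
by rewrite -!sum1_card -(eq_bigr _ cardA) exchange_big /= (eq_bigr _ cardB).
Qed.

(** Adding and removing rim hooks are inverse to each other, and preserve the
    row i as well as a and b. *)
Lemma sum_removable_addable d a b N : d + (a + b).+1 <= N ->
  \sum_(p : intpart_of (d + (a + b).+1))
    \sum_(i < N) removable_row a b (part p) i =
  \sum_(p : intpart_of d) \sum_(i < N) addable_row a b (part p) i.
Proof.
move=> dN; rewrite !pair_big /= -!big_mkcond /= !sum1_card.
pose S (x : intpart_of (d + (a + b).+1) * 'I_N) (y : intpart_of d * 'I_N) :=
  x.2 = y.2 /\ rim_hook_added a b x.2 (part y.1) (part x.1).
have anti n (p : intpart_of n) : forall m k, m <= k -> part p k <= part p m.
  by move=> m k; apply: part_anti.
apply: (@eq_card_rel _ _ _ _ S).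
- case=> p i; rewrite unfold_in /= => pi.
  have [f [fp f_anti fi]] := removable_rowP (@anti _ p) pi.
  (* The rim hook starts above row N, hence ends above row N + b. *)
  have iN : i + b < N + b by rewrite ltn_add2r.
  have f0 k : N + b <= k -> f k = 0.
    by case: fp => _ _ _ fhi Nk; rewrite -fhi ?(part_large p) //; lia.
  have f_sum : \sum_(k < N + b) f k = d.
    by have := rim_hook_added_sum iN fp; rewrite sum_part; lia.
  have [q qf] := ex_intpart_of f_anti f0 f_sum.
  by exists (q, i); rewrite ?unfold_in /S /= qf.
- case=> p i; rewrite unfold_in /= => pi.
  have [g [pg g_anti gi]] := addable_rowP (@anti _ p) pi.
  have iN : i + b < N + b by rewrite ltn_add2r.
  have g0 k : N + b <= k -> g k = 0.
    by case: pg => _ _ _ ghi Nk; rewrite ghi ?(part_large p) //; lia.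
  have g_sum : \sum_(k < N + b) g k = d + (a + b).+1.
    by rewrite (rim_hook_added_sum iN pg) sum_part; lia.
  have [q qg] := ex_intpart_of g_anti g0 g_sum.
  by exists (q, i); rewrite ?unfold_in /S /= qg.
- move=> [p i] [q j] [q' j'] [/= <- pq] [/= <- pq'].
  congr (_, _); apply/val_inj/part_inj.
  exact: rim_hook_added_inj pq pq' (frefl _).
- move=> [p i] [p' i'] [q j] [/= -> pq] [/= -> pq'].
  congr (_, _); apply/val_inj/part_inj.
  exact: rim_hook_added_fun pq pq' (frefl _).
Qed.

(** Each partition of d has one more addable row than removable rows, which
    gives the excess #|P_d|. *)
Lemma count_hooks_shift d a b :
  count (fun x : intpart_of (d + (a + b).+1) * (nat * nat) => arm x.1 x.2 == a)
    (hooks_of_length (d + (a + b).+1) (a + b).+1) =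
  #|{: intpart_of d}| +
  count (fun x : intpart_of d * (nat * nat) => arm x.1 x.2 == a)
    (hooks_of_length d (a + b).+1).
Proof.
pose N := (d + (a + b).+1).+1.
rewrite (@count_hooks _ N) // (@count_hooks _ N); last by rewrite /N; lia.
rewrite sum_removable_addable // -sum1_card -big_split /=.
apply: eq_bigr => p _; rewrite add1n sum_addable_row // => [k|].
  exact: part_anti.
by rewrite (part_large p) // leq_addr.
Qed.

Import GRing.Theory.
Local Open Scope ring_scope.

(** * Power series up to a given degree *)

Section LowDegree.
Variable R : comNzRingType.
Implicit Types f g : fps2 R.

Definition vanishes_below (N : nat) f : Prop :=
  forall m n, (m + n < N)%N -> coef2 f m n = 0.

Definition agree_below (N : nat) f g : Prop :=
  forall m n, (m + n < N)%N -> coef2 f m n = coef2 g m n.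

Lemma vanishes_belowM M N f g :
  vanishes_below M f -> vanishes_below N g -> vanishes_below (M + N) (f * g).
Proof.
move=> fM gN m n mn; rewrite coef2M; apply: big1 => i _; apply: big1 => j _.
have [ijM|Mij] := ltnP (i + j) M; first by rewrite fM ?mul0r.
by rewrite gN ?mulr0 //; move: (ltn_ord i) (ltn_ord j) mn Mij; lia.
Qed.

Lemma vanishes_belowX k f : coef2 f 0 0 = 0 -> vanishes_below k (f ^+ k).
Proof. by move=> f0 m n; apply: coef2X_small. Qed.

Lemma agree_belowM N f f' g g' :
  agree_below N f f' -> agree_below N g g' -> agree_below N (f * g) (f' * g').
Proof.
move=> ff gg m n mn; rewrite !coef2M.
apply: eq_bigr => i _; apply: eq_bigr => j _.
by rewrite ff ?gg //; move: (ltn_ord i) (ltn_ord j) mn; lia.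
Qed.

Lemma agree_below_prod1 N (I : Type) (s : seq I) (P : pred I)
    (F : I -> fps2 R) :
  (forall i, P i -> agree_below N (F i) 1) ->
  agree_below N (\prod_(i <- s | P i) F i) 1.
Proof.
move=> F1; elim/big_ind: _ => // f g f1 g1.
by rewrite -[1](mul1r 1); apply: agree_belowM.
Qed.

Lemma agree_belowV1 N f :
  f \is a GRing.unit -> agree_below N f 1 -> agree_below N f^-1 1.
Proof.
move=> fU f1 m n mn; rewrite -(divrr fU) -[in LHS](mul1r f^-1).
by apply/esym; apply: agree_belowM mn.
Qed.

End LowDegree.

(** * Convergent products *)

Section InfiniteProducts.
Variable R : comNzRingType.

(** The index sets that stabilise the finitely many coefficients of degree below
    N have a common upper bound, so convergence is uniform in bounded degree.
    Products of series need this, as one coefficient of a product involves many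
    coefficients of the factors. *)
Lemma has_prod_agree (I : choiceType) (D : pred I) (F : I -> fps2 R) f :
  has_prod D F f <-> forall N, exists A0 : {fset I}, forall A : {fset I},
    (A0 `<=` A)%fset -> agree_below N (\prod_(i <- A | D i) F i) f.
Proof.
split=> [Ff N | Ff m n]; last first.
  by have [A0 HA0] := Ff (m + n).+1; exists A0 => A /HA0; apply.
have [A0 HA0] : exists A0 : {fset I}, forall A, (A0 `<=` A)%fset ->
    {in [seq (m, n) | m <- iota 0 N, n <- iota 0 N], forall c,
      coef2 (\prod_(i <- A | D i) F i) c.1 c.2 = coef2 f c.1 c.2}.
  elim: [seq _ | m <- _, n <- _] => [|[m n] s [A1 HA1]]; first by exists fset0.
  have [A2 HA2] := Ff m n; exists (A1 `|` A2)%fset => A.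
  rewrite fsubUset => /andP[A1A A2A] c; rewrite inE => /predU1P[->|cs].
    exact: HA2.
  exact: HA1.
exists A0 => A /HA0 HA m n mn; apply: (HA (m, n)).
by apply/allpairsP; exists (m, n); rewrite !mem_iota /=; split => //; lia.
Qed.

Lemma has_prod_infprod (I : choiceType) (D : pred I) (F : I -> fps2 R) f :
  has_prod D F f -> infprod D F = f.
Proof.
move=> Ff; rewrite /infprod; case: xgetP => [g _ Fg|/(_ f)//].
exact: has_prod_unique Fg Ff.
Qed.

Lemma multipliable_infprod (I : choiceType) (D : pred I) (F : I -> fps2 R) :
  multipliable D F -> has_prod D F (infprod D F).
Proof. by case=> f Ff; rewrite (has_prod_infprod Ff). Qed.

Lemma eq_has_prod (I : choiceType) (D : pred I) (F G : I -> fps2 R) f :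
  (forall i, D i -> F i = G i) -> has_prod D F f -> has_prod D G f.
Proof.
move=> FG Ff m n; have [A0 HA0] := Ff m n.
by exists A0 => A /HA0 <-; rewrite (eq_bigr _ FG).
Qed.

Lemma has_prodM (I : choiceType) (D : pred I) (F G : I -> fps2 R) f g :
  has_prod D F f -> has_prod D G g ->
  has_prod D (fun i => F i * G i) (f * g).
Proof.
move=> /has_prod_agree Ff /has_prod_agree Gg; apply/has_prod_agree => N.
have [A HA] := Ff N; have [B HB] := Gg N; exists (A `|` B)%fset => C.
rewrite fsubUset big_split /= => /andP[AC BC].
by apply: agree_belowM; [apply: HA | apply: HB].
Qed.

Lemma has_prodX (I : choiceType) (D : pred I) (F : I -> fps2 R) f k :
  has_prod D F f -> has_prod D (fun i => F i ^+ k) (f ^+ k).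
Proof.
move=> Ff; elim: k => [|k IHk].
  by move=> m n; exists fset0 => A _; rewrite big1.
rewrite exprS; apply: eq_has_prod (has_prodM Ff IHk) => i _.
by rewrite exprS.
Qed.

(** The coefficient of x^m y^n is read off the product over [A0 (m + n).+1]:
    all further factors are 1 in degrees up to m + n. *)
Lemma multipliable_agree1 (I : choiceType) (D : pred I) (F : I -> fps2 R)
    (A0 : nat -> {fset I}) :
  (forall N i, D i -> i \notin A0 N -> agree_below N (F i) 1) ->
  multipliable D F.
Proof.
move=> F1.
have stable N (A : {fset I}) : (A0 N `<=` A)%fset ->
    agree_below N (\prod_(i <- A | D i) F i) (\prod_(i <- A0 N | D i) F i).
  move=> /fsetIidPr A0A.
  rewrite (big_fsetIDcond _ (mem (A0 N))) /=.
  have -> : [fset i in A | i \in A0 N]%fset = A0 N.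
    by rewrite -[RHS]A0A; apply/fsetP => i; rewrite !inE.
  rewrite -[X in agree_below N _ X]mulr1; apply: agree_belowM => //.
  rewrite big_seq_cond; apply: agree_below_prod1 => i.
  by rewrite !inE => /andP[/andP[_ iA0] Di]; apply: F1.
exists (Fps2 (fun m n =>
  coef2 (\prod_(i <- A0 (m + n).+1 | D i) F i) m n)) => m n.
by exists (A0 (m + n).+1) => A /stable; apply.
Qed.

(** Infinite associativity: the finite unions of blocks are cofinal among the
    finite sets of indices. *)
Lemma has_prod_blocks (I J : choiceType) (D : pred I) (E : pred J)
    (F : I -> fps2 R) f (p : I -> J) (block : J -> seq I) :
  (forall j, uniq (block j)) ->
  (forall i j, E j -> (i \in block j) = D i && (p i == j)) ->
  (forall i, D i -> E (p i)) ->
  has_prod D F f -> has_prod E (fun j => \prod_(i <- block j) F i) f.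
Proof.
move=> blockU blockP DE Ff m n; have [A0 HA0] := Ff m n.
exists [fset p i | i in A0]%fset => B pA0B.
(* s lists the indices that lie in the blocks numbered by B. *)
pose s := flatten [seq block j | j <- B & E j].
have sP i : (i \in s) = D i && (p i \in B).
  apply/flatten_mapP/andP => [[j]|[Di piB]].
    rewrite mem_filter => /andP[Ej jB]; rewrite blockP //.
    by move=> /andP[-> /eqP ->].
  have Ep := DE _ Di.
  by exists (p i); rewrite ?mem_filter ?Ep // blockP // Di eqxx.
have sU : uniq s.
  rewrite /s; have := fset_uniq B.
  elim: (enum_fset B) => //= j r IHr /andP[jr rU].
  case: ifP => Ej /=; last exact: IHr.
  rewrite cat_uniq blockU IHr // andbT /=; apply/hasPn => i /flatten_mapP[k].
  rewrite mem_filter => /andP[Ek kr]; rewrite blockP // => /andP[Di /eqP pik].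
  by rewrite blockP // Di /= pik; apply: contra jr => /eqP <-.
have -> : \prod_(j <- B | E j) \prod_(i <- block j) F i = \prod_(i <- s) F i.
  by rewrite /s big_flatten big_map big_filter.
rewrite -(HA0 (A0 `|` [fset i in s])%fset) ?fsubsetUl // -[in RHS]big_filter.
congr (coef2 _ m n); apply/perm_big/uniq_perm => //.
  by rewrite filter_uniq.
move=> i; rewrite mem_filter !inE sP; case: (boolP (D i)) => //= Di.
case: (boolP (i \in A0)) => //= iA0.
by rewrite (fsubsetP pA0B) // in_imfset.
Qed.
End InfiniteProducts.

(** * The products over hooks *)

Definition hook_term (a b : nat) : fps2 int :=
  (1 - fps2_X ^+ a.+1 * fps2_Y ^+ b)^-1.

Lemma hook_factorE (p : intpart) b :
  hook_factor p b = hook_term (arm p b) (leg p b).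
Proof. by []. Qed.

(** 1 - x^(a+1) y^b is 1 in degrees up to a + b, hence so is its inverse. *)
Lemma hook_term_agree1 a b : agree_below (a + b).+1 (hook_term a b) 1.
Proof.
have vXY : vanishes_below (a + b).+1
    (fps2_X ^+ a.+1 * fps2_Y ^+ b : fps2 int).
  by rewrite -addSn; apply: vanishes_belowM; apply: vanishes_belowX.
apply: agree_belowV1; first by apply: fps2_unit_1B; apply: vXY.
by move=> m n mn; rewrite coef2B vXY ?subr0.
Qed.

Lemma hook_factor_agree1 (p : intpart) b :
  agree_below (hook p b) (hook_factor p b) 1.
Proof. exact: hook_term_agree1. Qed.

(** A hook of length l + 1 and arm a has leg l - a, so factors can be collected
    by their arms. *)
Lemma prod_hooks n l :
  \prod_(x <- hooks_of_length n l.+1) hook_factor x.1 x.2 =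
  \prod_(a < l.+1) hook_term a (l - a) ^+
    count (fun x : intpart_of n * (nat * nat) => arm x.1 x.2 == a)
      (hooks_of_length n l.+1).
Proof.
rewrite big_seq.
rewrite (partition_big (fun x : intpart_of n * (nat * nat) =>
  inord (arm x.1 x.2) : 'I_l.+1) xpredT) //=.
apply: eq_bigr => a _.
rewrite -iter_mulr_1 -big_const_seq -big_filter -[RHS]big_filter.
have armP x : x \in hooks_of_length n l.+1 ->
    (arm x.1 x.2 + leg x.1 x.2 = l)%N.
  by rewrite in_hooks_of_length => /andP[_ /eqP[]].
have -> : [seq x : intpart_of n * (nat * nat) <- hooks_of_length n l.+1 |
      (x \in hooks_of_length n l.+1) && (inord (arm x.1 x.2) == a)] =
    [seq x : intpart_of n * (nat * nat) <- hooks_of_length n l.+1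
      | arm x.1 x.2 == a].
  apply: eq_in_filter => x xH; rewrite xH /= -val_eqE /= inordK //.
  by rewrite ltnS -(armP x xH) leq_addr.
apply: eq_big_seq => x; rewrite mem_filter => /andP[/eqP xa xH].
rewrite hook_factorE xa; congr hook_term.
by rewrite -[LHS](addKn a) -[X in (X + _ - _)%N]xa armP.
Qed.

(** The boxes (i, j) whose hook, as an external hook of the empty partition, has
    length i + j + 1 = l. *)
Definition empty_hooks (l : nat) : seq (nat * nat) :=
  [seq (l.-1 - a, a)%N | a <- iota 0 l].

Lemma prod_empty_hooks l :
  \prod_(b <- empty_hooks l.+1) hook_factor empty_part b =
  \prod_(a < l.+1) hook_term a (l - a).
Proof.
rewrite big_map -(big_mkord xpredT (fun a => hook_term a (l - a))).
rewrite /index_iota subn0.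
by apply: eq_bigr => a _; rewrite hook_factorE arm_empty leg_empty.
Qed.

(** Each arm a < l occurs once among the empty hooks of length l, hence #|P_d|
    times in the power; this matches the excess in [count_hooks_shift]. *)
Lemma prod_hooks_shift d l : (0 < l)%N ->
  \prod_(x <- hooks_of_length (d + l) l) hook_factor x.1 x.2 =
  (\prod_(b <- empty_hooks l) hook_factor empty_part b) ^+ #|{: intpart_of d}| *
  \prod_(x <- hooks_of_length d l) hook_factor x.1 x.2.
Proof.
case: l => // l _; rewrite !prod_hooks prod_empty_hooks -prodrXl -big_split /=.
apply: eq_bigr => a _; rewrite -exprD.
have al : (a + (l - a))%N = l by apply: subnKC; rewrite -ltnS.
by congr (_ ^+ _); have := count_hooks_shift d a (l - a); rewrite al.
Qed.

Theorem proposition1p6 (d : nat) :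
  let lhs (l : nat) :=
    \prod_(x <- hooks_of_length (d + l) l) hook_factor x.1 x.2 in
  let rhs (l : nat) :=
    \prod_(x <- hooks_of_length d l) hook_factor x.1 x.2 in
  [/\ multipliable (fun l => (0 < l)%N) lhs,
      multipliable (external_hooks empty_part) (hook_factor empty_part),
      multipliable (fun l => (0 < l)%N) rhs
    & infprod (fun l => (0 < l)%N) lhs =
      infprod (external_hooks empty_part) (hook_factor empty_part)
        ^+ #|{: intpart_of d}| *
      infprod (fun l => (0 < l)%N) rhs].
Proof.
move=> lhs rhs.
have rhs_mult : multipliable (fun l => (0 < l)%N) rhs.
  pose A0 N := [fset l in iota 0 N]%fset.
  apply: (@multipliable_agree1 _ _ _ _ A0) => N l _.
  rewrite !inE mem_iota /= -leqNgt => Nl.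
  rewrite /rhs big_seq; apply: agree_below_prod1 => x.
  rewrite in_hooks_of_length => /andP[_ /eqP xl] m n mn.
  by apply: hook_factor_agree1; rewrite xl (leq_trans mn).
have ext_mult :
    multipliable (external_hooks empty_part) (hook_factor empty_part).
  pose A0 N := [fset b in [seq (i, j) | i <- iota 0 N, j <- iota 0 N]]%fset.
  apply: (@multipliable_agree1 _ _ _ _ A0) => N [i j] _; rewrite !inE.
  move=> ijN m n mn; apply: hook_factor_agree1.
  apply: leq_trans mn _; rewrite leqNgt; apply: contra ijN => ijN.
  apply/allpairsP; exists (i, j); rewrite !mem_iota.
  by move: ijN; rewrite /hook arm_empty leg_empty /=; split=> //; lia.
(* Each box is an external hook of the empty partition of length i + j + 1. *)
have blocks : has_prod (fun l => (0 < l)%N)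
    (fun l => \prod_(b <- empty_hooks l) hook_factor empty_part b)
    (infprod (external_hooks empty_part) (hook_factor empty_part)).
  apply: (has_prod_blocks (p := fun b => (b.1 + b.2).+1))
    (multipliable_infprod ext_mult) => //.
  - move=> l; rewrite map_inj_uniq ?iota_uniq // => a a' [] //.
  move=> [i j] l l0; rewrite /external_hooks /= mem_diagram /part nth_nil /=.
  apply/mapP/eqP => [[a]|<-]; last first.
    by exists j; rewrite ?addnK // mem_iota; lia.
  by rewrite mem_iota => al [-> ->]; lia.
have lhs_prod := has_prodM (has_prodX #|{: intpart_of d}| blocks)
  (multipliable_infprod rhs_mult).
have {}lhs_prod :=
  eq_has_prod (fun l l0 => esym (prod_hooks_shift d l0)) lhs_prod.
by split=> //; [eexists; exact: lhs_prod | apply: has_prod_infprod].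
Qed.
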